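(* Every solvable three-dimensional subalgebra of $\mathfrak{b}$ which contains a nonzero semisimple element which has zero as an eigenvalue but does not contain a Cartan subalgebra is equivalent to one of the following inequivalent algebras: $$\langle T_{1,0},X_{\alpha},X_{\alpha+\beta}\rangle,\qquad \langle T_{1,0},X_{\alpha},X_{\alpha+2\beta}\rangle,\qquad \langle T_{1,0},X_{\alpha+\beta},X_{\alpha+2\beta}\rangle .$$
   Context: Let $J=\begin{pmatrix}0&0&1&0\\0&0&0&1\\-1&0&0&0\\0&-1&0&0\end{pmatrix}$. $\mathfrak{sp}(4,\mathbb{C})$ is the Lie algebra of $4\times4$ complex matrices $X$ with $JX^tJ=X$, and $Sp(4,\mathbb{C})=\{g\in GL(4,\mathbb{C}) : gJg^t=J\}$, acting on $\mathfrak{sp}(4,\mathbb{C})$ by conjugation $X\mapsto gXg^{-1}$. For $a,b\in\mathbb{C}$, $T_{a,b}=\mathrm{diag}(a,b,-a,-b)$, and $\mathfrak{t}=\{T_{a,b}: a,b\in\mathbb{C}\}$. A Cartan subalgebra of $\mathfrak{sp}(4,\mathbb{C})$ is a two-dimensional subalgebra of commuting semisimple (diagonalizable) elements. With $E_{ij}$ the matrix units, $X_\alpha=E_{24}$, $X_\beta=E_{12}-E_{43}$, $X_{\alpha+\beta}=E_{14}+E_{23}$, $X_{\alpha+2\beta}=E_{13}$. $\langle\,\cdot\,\rangle$ denotes the complex linear span. $\mathfrak{b}=\mathfrak{t}\oplus\langle X_\alpha,X_\beta,X_{\alpha+\beta},X_{\alpha+2\beta}\rangle$ is the Borel subalgebra.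 Two subalgebras are equivalent if some $g\in Sp(4,\mathbb{C})$ conjugates one onto the other. *)

(* Defs.v *)
From HB Require Import structures.
From mathcomp Require Import all_boot all_order all_algebra.
From mathcomp Require Import reals.
From mathcomp Require Export complex.

Set Implicit Arguments.
Unset Strict Implicit.
Unset Printing Implicit Defensive.

Import GRing.Theory.
Local Open Scope ring_scope.

Definition lie_bracket (F : fieldType) (n : nat) (A B : 'M[F]_n) : 'M[F]_n :=
  A *m B - B *m A.

(* The span of all brackets of an element of U with an element of V. As for
   prodv, the brackets of basis vectors suffice, see lie_prodvP. *)
Definition lie_prodv (F : fieldType) (n : nat) (U V : {vspace 'M[F]_n}) :
    {vspace 'M[F]_n} :=
  <<[seq lie_bracket u v | u <- vbasis U, v <- vbasis V]>>%VS.

Definition derived_series (F : fieldType) (n : nat) (S : {vspace 'M[F]_n})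
    (k : nat) : {vspace 'M[F]_n} :=
  iter k (fun V => lie_prodv V V) S.

Definition lie_solvable (F : fieldType) (n : nat) (S : {vspace 'M[F]_n}) : Prop :=
  exists k : nat, derived_series S k = 0%VS.

Definition J (F : fieldType) : 'M[F]_4 :=
  block_mx (0 : 'M[F]_2) (1%:M : 'M[F]_2) (- 1%:M : 'M[F]_2) (0 : 'M[F]_2).

Definition in_sp4 (F : fieldType) (X : 'M[F]_4) : Prop :=
  J F *m X^T *m J F = X.

Definition in_Sp4 (F : fieldType) (g : 'M[F]_4) : Prop :=
  g \in unitmx /\ g *m J F *m g^T = J F.

Definition sp4_subalgebra (F : fieldType) (S : {vspace 'M[F]_4}) : Prop :=
  (forall X, X \in S -> in_sp4 X) /\
  (forall X Y, X \in S -> Y \in S -> lie_bracket X Y \in S).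

Definition cartan_subalgebra (F : fieldType) (H : {vspace 'M[F]_4}) : Prop :=
  [/\ sp4_subalgebra H, \dim H = 2%N,
      forall X Y, X \in H -> Y \in H -> lie_bracket X Y = 0
    & forall X, X \in H -> diagonalizable X].

Definition conjv (F : fieldType) (g : 'M[F]_4) (S : {vspace 'M[F]_4}) :
    {vspace 'M[F]_4} :=
  (linfun (mulmxr (invmx g) \o mulmx g) @: S)%VS.

Definition Sp4_equivalent (F : fieldType) (S S' : {vspace 'M[F]_4}) : Prop :=
  exists2 g : 'M[F]_4, in_Sp4 g & conjv g S = S'.

(* Matrix units with indices counted from 1, as in E_{11}, ..., E_{44}. *)
Definition E (F : fieldType) (i j : nat) : 'M[F]_4 :=
  delta_mx (inord i.-1) (inord j.-1).

Definition T (F : fieldType) (a b : F) : 'M[F]_4 :=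
  diag_mx (\row_(j < 4) [:: a; b; - a; - b]`_j).

Definition X_a (F : fieldType) : 'M[F]_4 := E F 2 4.
Definition X_b (F : fieldType) : 'M[F]_4 := E F 1 2 - E F 4 3.
Definition X_ab (F : fieldType) : 'M[F]_4 := E F 1 4 + E F 2 3.
Definition X_a2b (F : fieldType) : 'M[F]_4 := E F 1 3.

(* The torus {T a b}, see mem_torus. *)
Definition torus (F : fieldType) : {vspace 'M[F]_4} := <<[:: T 1 0; T 0 1]>>%VS.

Definition borel (F : fieldType) : {vspace 'M[F]_4} :=
  (torus F + <<[:: X_a F; X_b F; X_ab F; X_a2b F]>>)%VS.

Lemma lie_prodvP (F : fieldType) (n : nat) (U V W : {vspace 'M[F]_n}) :
  reflect (forall u v, u \in U -> v \in V -> lie_bracket u v \in W)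
          (lie_prodv U V <= W)%VS.
Proof.
apply: (iffP idP) => [sUVW u v Uu Vv | sUVW]; last first.
  by apply/span_subvP=> _ /allpairsP[[u v] /= [Uu Vv ->]];
    rewrite sUVW ?vbasis_mem.
apply: (subvP sUVW); rewrite (coord_vbasis Uu) (coord_vbasis Vv) /lie_bracket.
rewrite mulmx_suml mulmx_sumr -sumrB; apply: memv_suml => i _.
rewrite mulmx_sumr mulmx_suml -sumrB; apply: memv_suml => j _.
rewrite -!scalemxAl -!scalemxAr !scalerA [in X in _ - X]mulrC -scalerBr.
by apply/memvZ/memv_span/allpairs_f; apply: mem_nth; rewrite size_tuple.
Qed.

Lemma mem_torus (F : fieldType) (X : 'M[F]_4) :
  X \in torus F <-> exists a b, X = T a b.
Proof.
have TE a b : T a b = a *: T 1 0 + b *: T 0 1 :> 'M[F]_4.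
  apply/matrixP=> i j; rewrite !mxE; case: (i == j); last by rewrite !mulr0 addr0.
  case: i => [[|[|[|[|k]]]] lt_k4] //=;
    by rewrite !mulr1n ?oppr0 ?mulrN1 ?mulr1 ?mulr0 ?addr0 ?add0r.
rewrite /torus span_cons span_seq1; split.
  by move=> /memv_addP[_ /vlineP[a ->] [_ /vlineP[b ->] ->]]; exists a, b; rewrite -TE.
by case=> a [b ->]; rewrite TE memv_add ?memvZ ?memv_line.
Qed.

Lemma mem_conjv (F : fieldType) (g : 'M[F]_4) (S : {vspace 'M[F]_4}) (Y : 'M[F]_4) :
  Y \in conjv g S <-> exists2 X, X \in S & Y = g *m X *m invmx g.
Proof.
split=> [/memv_imgP[X SX ->] | [X SX ->]]; first by exists X; rewrite ?lfunE.
by apply/memv_imgP; exists X; rewrite ?lfunE.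
Qed.

(* Main.v *)
(* A semisimple element of the Borel subalgebra with eigenvalue zero has torus
   part T a 0 or T 0 b, and a unipotent element of the Borel subgroup conjugates
   it to that part.  So S may be assumed to contain T 1 0 or T 0 1, and is then
   the sum of its weight spaces under the adjoint action of that element.  The
   zero weight space cannot contain a second independent semisimple element,
   since S would contain a conjugate of the torus.  The few sets of root vectors
   that remain are moved to one of the three normal forms by Weyl group elements
   or, for the line spanned by y X_b + z X_ab, by SL_2 acting on indices 2, 4.
   The three algebras differ by their brackets: all of them are multiples of the
   rank two matrix X_ab for the first, of the rank one matrix X_a2b for the
   second, and the third has brackets of both kinds. *)
Require Import Defs.
From mathcomp Require Import all_boot all_order all_algebra.
From mathcomp Require Import reals ring.

Set Implicit Arguments.
Unset Strict Implicit.
Unset Printing Implicit Defensive.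

Import GRing.Theory.
Local Open Scope ring_scope.

(** In diagonal form, [p] vanishing at [A] makes every diagonal entry a root of [p], hence of [q].
    This lets repeated factors be dropped from an annihilating polynomial. *)
Lemma diagonalizable_horner0 (F : fieldType) (n : nat) (A : 'M[F]_n.+1)
    (p q : {poly F}) :
  diagonalizable A -> (forall x, root p x -> root q x) ->
  horner_mx A p = 0 -> horner_mx A q = 0.
Proof.
case=> P Pu /(similar_diagLR Pu)[d ->] pq.
rewrite conjVmx // !horner_mx_uconjC // !horner_mx_diag => A0.
have {A0} d0 : diag_mx (map_mx (horner p) d) = 0.
  rewrite -[LHS]mulmx1 -(mulmxV Pu) mulmxA -[X in X *m P]mul1mx -(mulmxV Pu).
  by rewrite -(mulmxA P) -(mulmxA P) A0 mulmx0 mul0mx.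
suff -> : map_mx (horner q) d = 0 by rewrite linear0 mulmx0 mul0mx.
apply/rowP=> i; rewrite !mxE; apply/eqP/pq/eqP.
by have /matrixP/(_ i i) := d0; rewrite !mxE eqxx mulr1n.
Qed.

(** Literal rows turn a matrix identity into sixteen scalar ones for [ring]. *)
Definition mx4 {F : fieldType} (r : seq (seq F)) : 'M[F]_4 :=
  \matrix_(i < 4, j < 4) (nth [::] r i)`_j.

Lemma mx4P (F : fieldType) (A B : 'M[F]_4) :
  (forall i j (lti : (i < 4)%N) (ltj : (j < 4)%N),
     A (Ordinal lti) (Ordinal ltj) = B (Ordinal lti) (Ordinal ltj)) -> A = B.
Proof. by move=> AB; apply/matrixP=> -[i lti] [j ltj]. Qed.

Ltac mx4_entries :=
  apply: mx4P => -[|[|[|[|i]]]] [|[|[|[|j]]]] // lti ltj.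

Ltac mx4_simp := rewrite !mxE /=
  ?(mulr0n, mulr1n, oppr0, subr0, sub0r, addr0, add0r).

(** * Arithmetic of explicit 4 by 4 matrices *)

Section Mx4.

Variable F : fieldType.

Variables a11 a12 a13 a14 a21 a22 a23 a24 a31 a32 a33 a34 a41 a42 a43 a44 : F.

Local Notation A := (mx4 [:: [:: a11; a12; a13; a14]; [:: a21; a22; a23; a24];
  [:: a31; a32; a33; a34]; [:: a41; a42; a43; a44]]).

Lemma mx4N : - A = mx4 [:: [:: -a11; -a12; -a13; -a14];
  [:: -a21; -a22; -a23; -a24]; [:: -a31; -a32; -a33; -a34];
  [:: -a41; -a42; -a43; -a44]].
Proof. by mx4_entries; rewrite !mxE. Qed.

Lemma mx4Z c : c *: A = mx4 [:: [:: c * a11; c * a12; c * a13; c * a14];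
  [:: c * a21; c * a22; c * a23; c * a24];
  [:: c * a31; c * a32; c * a33; c * a34];
  [:: c * a41; c * a42; c * a43; c * a44]].
Proof. by mx4_entries; rewrite !mxE. Qed.

Lemma mx4_tr : A^T = mx4 [:: [:: a11; a21; a31; a41];
  [:: a12; a22; a32; a42]; [:: a13; a23; a33; a43]; [:: a14; a24; a34; a44]].
Proof. by mx4_entries; rewrite !mxE. Qed.

Variables b11 b12 b13 b14 b21 b22 b23 b24 b31 b32 b33 b34 b41 b42 b43 b44 : F.

Local Notation B := (mx4 [:: [:: b11; b12; b13; b14]; [:: b21; b22; b23; b24];
  [:: b31; b32; b33; b34]; [:: b41; b42; b43; b44]]).

Lemma mx4D : A + B = mx4 [::
  [:: a11 + b11; a12 + b12; a13 + b13; a14 + b14];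
  [:: a21 + b21; a22 + b22; a23 + b23; a24 + b24];
  [:: a31 + b31; a32 + b32; a33 + b33; a34 + b34];
  [:: a41 + b41; a42 + b42; a43 + b43; a44 + b44]].
Proof. by mx4_entries; rewrite !mxE. Qed.

Let dot (x1 x2 x3 x4 y1 y2 y3 y4 : F) := x1 * y1 + x2 * y2 + x3 * y3 + x4 * y4.

Lemma mx4M : A *m B = mx4 [::
  [:: dot a11 a12 a13 a14 b11 b21 b31 b41; dot a11 a12 a13 a14 b12 b22 b32 b42;
      dot a11 a12 a13 a14 b13 b23 b33 b43; dot a11 a12 a13 a14 b14 b24 b34 b44];
  [:: dot a21 a22 a23 a24 b11 b21 b31 b41; dot a21 a22 a23 a24 b12 b22 b32 b42;
      dot a21 a22 a23 a24 b13 b23 b33 b43; dot a21 a22 a23 a24 b14 b24 b34 b44];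
  [:: dot a31 a32 a33 a34 b11 b21 b31 b41; dot a31 a32 a33 a34 b12 b22 b32 b42;
      dot a31 a32 a33 a34 b13 b23 b33 b43; dot a31 a32 a33 a34 b14 b24 b34 b44];
  [:: dot a41 a42 a43 a44 b11 b21 b31 b41; dot a41 a42 a43 a44 b12 b22 b32 b42;
      dot a41 a42 a43 a44 b13 b23 b33 b43; dot a41 a42 a43 a44 b14 b24 b34 b44]].
Proof.
by mx4_entries; rewrite !mxE !big_ord_recr big_ord0 /= add0r !mxE.
Qed.

End Mx4.

Lemma J_mx4 (F : fieldType) : J F = mx4 [:: [:: 0; 0; 1; 0]; [:: 0; 0; 0; 1];
  [:: -1; 0; 0; 0]; [:: 0; -1; 0; 0]].
Proof.
mx4_entries; rewrite /J /block_mx !mxE; case: splitP => k /= kE;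
  rewrite !mxE; case: splitP => l /= lE; rewrite !mxE //;
  by case: k kE => -[|[|k]] ? //= _; case: l lE => -[|[|l]] ? //= _; rewrite ?oppr0.

Qed.

(* The element T a b + x X_a + y X_b + z X_ab + w X_a2b of the Borel subalgebra. *)
Definition bor {F : fieldType} (a b x y z w : F) : 'M[F]_4 := mx4
  [:: [:: a; y; w; z]; [:: 0; b; z; x]; [:: 0; 0; -a; 0]; [:: 0; 0; -y; -b]].

Ltac mx4_ring := rewrite ?/bor ?J_mx4 ?mx4_tr ?mx4M ?mx4M;
  congr (mx4 _); do ![congr (_ :: _)]; ring.

(** * Coordinates and brackets in the Borel subalgebra *)

Section Borel.

Variable F : fieldType.

Lemma E_delta i j : (i < 4)%N -> (j < 4)%N ->
  E F i.+1 j.+1 = \matrix_(k < 4, l < 4) ((k == i :> nat) && (l == j :> nat))%:R.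
Proof. by move=> lti ltj; apply/matrixP=> k l; rewrite !mxE -!val_eqE /= !inordK. Qed.

Lemma T_bor (a b : F) : T a b = bor a b 0 0 0 0.
Proof. by mx4_entries; mx4_simp. Qed.

Lemma X_a_bor : X_a F = bor 0 0 1 0 0 0.
Proof. by rewrite /X_a E_delta //; mx4_entries; mx4_simp. Qed.

Lemma X_b_bor : X_b F = bor 0 0 0 1 0 0.
Proof. by rewrite /X_b !E_delta //; mx4_entries; mx4_simp. Qed.

Lemma X_ab_bor : X_ab F = bor 0 0 0 0 1 0.
Proof. by rewrite /X_ab !E_delta //; mx4_entries; mx4_simp. Qed.

Lemma X_a2b_bor : X_a2b F = bor 0 0 0 0 0 1.
Proof. by rewrite /X_a2b E_delta //; mx4_entries; mx4_simp. Qed.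

Definition bor_basis := (T_bor, X_a_bor, X_b_bor, X_ab_bor, X_a2b_bor).

Lemma borD a b x y z w a' b' x' y' z' w' :
  bor a b x y z w + bor a' b' x' y' z' w' =
  bor (a + a') (b + b') (x + x') (y + y') (z + z') (w + w') :> 'M[F]_4.
Proof. by rewrite /bor mx4D !addr0 !opprD. Qed.

Lemma borZ c a b x y z w :
  c *: bor a b x y z w = bor (c * a) (c * b) (c * x) (c * y) (c * z) (c * w) :> 'M[F]_4.
Proof. by rewrite /bor mx4Z !mulr0 !mulrN. Qed.

(** All structure constants at once: [X_a], [X_b], [X_ab], [X_a2b] have weights 2b, a - b, a + b,
    2a, and the mixed terms are [[X_b], [X_a]] = [X_ab] and [[X_b], [X_ab]] = 2 [X_a2b]. *)
Lemma bor_bracket a b x y z w a' b' x' y' z' w' :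
  lie_bracket (bor a b x y z w) (bor a' b' x' y' z' w') =
  bor 0 0 (2%:R * (b * x' - b' * x)) ((a - b) * y' - (a' - b') * y)
    ((a + b) * z' - (a' + b') * z + y * x' - y' * x)
    (2%:R * (a * w' - a' * w + y * z' - y' * z)) :> 'M[F]_4.
Proof.
by rewrite /lie_bracket /bor !mx4M mx4N mx4D; congr (mx4 _); do ![congr (_ :: _)]; ring.
Qed.

Lemma bor0 : bor 0 0 0 0 0 0 = 0 :> 'M[F]_4.
Proof. by mx4_entries; mx4_simp. Qed.

Lemma bor_inj a b x y z w a' b' x' y' z' w' :
  bor a b x y z w = bor a' b' x' y' z' w' :> 'M[F]_4 ->
  [/\ a = a', b = b', x = x', y = y' & z = z' /\ w = w'].
Proof.
move=> /matrixP eqX; have e i j := eqX (inord i) (inord j).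
split; [move: (e 0 0)%N | move: (e 1 1)%N | move: (e 1 3)%N | move: (e 0 1)%N |
  split; [move: (e 0 3)%N | move: (e 0 2)%N]]; by rewrite !mxE !inordK.
Qed.

Lemma mem_borelP (X : 'M[F]_4) :
  reflect (exists a b x y z w, X = bor a b x y z w) (X \in borel F).
Proof.
have borE a b x y z w : bor a b x y z w = a *: T 1 0 + b *: T 0 1 +
    (x *: X_a F + (y *: X_b F + (z *: X_ab F + w *: X_a2b F))).
  rewrite !bor_basis !(borZ, borD); congr bor; ring.
rewrite /borel /torus !span_cons span_nil !addv0.
apply: (iffP idP) => [|[a [b [x [y [z [w ->]]]]]]].
  case/memv_addP=> _ /memv_addP[_ /vlineP[a ->] [_ /vlineP[b ->] ->]].
  case=> _ /memv_addP[_ /vlineP[x ->] [_ /memv_addP[_ /vlineP[y ->]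
    [_ /memv_addP[_ /vlineP[z ->] [_ /vlineP[w ->] ->]] ->]] ->]] ->.
  by exists a, b, x, y, z, w; rewrite borE.
by rewrite borE !memv_add // memvZ ?memv_line.
Qed.

Lemma bor_sp4 a b x y z w : in_sp4 (bor a b x y z w : 'M[F]_4).
Proof.
rewrite /in_sp4 J_mx4 /bor mx4_tr !mx4M.
by congr (mx4 _); do ![congr (_ :: _)]; ring.
Qed.

End Borel.

(** * Conjugation by the symplectic group *)

Lemma invmxM (R : comUnitRingType) (n : nat) (A B : 'M[R]_n) :
  A \in unitmx -> B \in unitmx -> invmx (A *m B) = invmx B *m invmx A.
Proof.
move=> Au Bu; rewrite -[LHS]mul1mx -(mulVmx Bu) -[X in _ *m X *m _](mulKmx Au).
by rewrite -!mulmxA (mulmxA A) mulmxV ?unitmx_mul ?Au // mulmx1.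
Qed.

Section Conjugation.

Variable F : fieldType.

Implicit Types (g X Y : 'M[F]_4) (S H : {vspace 'M[F]_4}).

Lemma mulJJ : J F *m J F = - 1%:M.
Proof.
rewrite J_mx4 mx4M; mx4_entries; rewrite !mxE /=; ring.
Qed.

(** Since J squares to -1, the relation exhibits -J g^T J as an inverse of g, so invertibility comes
    for free. *)
Lemma in_Sp4I g : g *m J F *m g^T = J F -> in_Sp4 g.
Proof.
move=> gJ; split=> //; have: g *m (- (J F *m g^T *m J F)) = 1%:M.
  by rewrite mulmxN !mulmxA gJ mulJJ opprK.
by case/mulmx1_unit.
Qed.

Lemma in_Sp4_mul g h : in_Sp4 g -> in_Sp4 h -> in_Sp4 (g *m h).
Proof.
move=> [gu gJ] [hu hJ]; split; first by rewrite unitmx_mul gu.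
by rewrite trmx_mul mulmxA -(mulmxA g) -(mulmxA g) hJ.
Qed.

Lemma in_Sp4_inv g : in_Sp4 g -> in_Sp4 (invmx g).
Proof.
move=> [gu gJ]; split; first by rewrite unitmx_inv.
rewrite -[in LHS]gJ !mulmxA mulVmx // mul1mx -mulmxA -trmx_mul mulVmx //.
by rewrite trmx1 mulmx1.
Qed.

(** The right inverse -J g^T J of g is also a left inverse; multiplying that identity by -J gives
    the claim. *)
Lemma Sp4_tr g : in_Sp4 g -> g^T *m J F *m g = J F.
Proof.
case=> gu gJ; have : g *m - (J F *m g^T *m J F) = 1%:M.
  by rewrite mulmxN !mulmxA gJ mulJJ opprK.
move/mulmx1C; rewrite mulNmx => /eqP; rewrite eqr_oppLR => /eqP JJ.
have := congr1 (mulmx (- J F)) JJ.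
by rewrite !mulNmx !mulmxA mulJJ !mulNmx !mul1mx opprK mulmxN mulmx1 opprK.
Qed.

Lemma conjv_comp g h S : in_Sp4 g -> in_Sp4 h ->
  conjv g (conjv h S) = conjv (g *m h) S.
Proof.
move=> [gu _] [hu _]; apply/vspaceP=> Y; apply/idP/idP.
  case/mem_conjv=> _ /mem_conjv[X SX ->] ->; apply/mem_conjv; exists X => //.
  by rewrite invmxM // !mulmxA.
case/mem_conjv=> X SX ->; apply/mem_conjv; exists (h *m X *m invmx h).
  by apply/mem_conjv; exists X.
by rewrite invmxM // !mulmxA.
Qed.

Lemma conjv1 S : conjv 1%:M S = S.
Proof.
apply/vspaceP=> Y; apply/idP/idP.
  by case/mem_conjv=> X SX ->; rewrite invmx1 mul1mx mulmx1.
by move=> SY; apply/mem_conjv; exists Y => //; rewrite invmx1 mul1mx mulmx1.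
Qed.

Lemma conjvK g S : in_Sp4 g -> conjv (invmx g) (conjv g S) = S.
Proof.
move=> Sp; rewrite conjv_comp //; last exact: in_Sp4_inv.
by rewrite mulVmx ?conjv1 //; case: Sp.
Qed.

(** A linear image never has larger dimension; applying this to g and then to its inverse gives
    equality. *)
Lemma dim_conjv g S : in_Sp4 g -> \dim (conjv g S) = \dim S.
Proof.
have le h U : (\dim (conjv h U : {vspace 'M[F]_4}) <= \dim U)%N.
  by rewrite -(limg_ker_dim (linfun (mulmxr (invmx h) \o mulmx h)) U) leq_addl.
move=> Sp; apply/eqP; rewrite eqn_leq le /=.
by rewrite -[X in (\dim X <= _)%N](conjvK S Sp) le.
Qed.

Lemma conjvS g S H : (S <= H)%VS -> (conjv g S <= conjv g H)%VS.
Proof. exact: limgS. Qed.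

Lemma lie_bracket_conj g X Y : g \in unitmx ->
  lie_bracket (g *m X *m invmx g) (g *m Y *m invmx g) =
  g *m lie_bracket X Y *m invmx g.
Proof.
move=> gu; rewrite /lie_bracket mulmxBr mulmxBl.
by rewrite !mulmxA !(mulmxKV gu).
Qed.

(** The rules [JgT] and [gTJ] carry J past the transposed factors, leaving g (J X^T J) g^-1. *)
Lemma in_sp4_conj g X : in_Sp4 g -> in_sp4 X -> in_sp4 (g *m X *m invmx g).
Proof.
move=> Sp spX; have [gu gJ] := Sp; have [giu giJ] := in_Sp4_inv Sp.
have trgJ := Sp4_tr (in_Sp4_inv Sp).
have JgT : J F *m (invmx g)^T = g *m J F.
  by rewrite -[J F in RHS]giJ !mulmxA mulmxV // mul1mx.
have gTJ : g^T *m J F = J F *m invmx g.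
  have := Sp4_tr Sp => /(congr1 (mulmx^~ (invmx g))).
  by rewrite mulmxK.
rewrite /in_sp4 !trmx_mul !mulmxA JgT -!mulmxA gTJ !mulmxA -{2}spX.
by rewrite !mulmxA.
Qed.

Lemma sp4_subalgebra_conj g S :
  in_Sp4 g -> sp4_subalgebra S -> sp4_subalgebra (conjv g S).
Proof.
move=> Sp [spS brS]; split.
  by move=> _ /mem_conjv[X SX ->]; apply/in_sp4_conj/spS.
move=> _ _ /mem_conjv[X SX ->] /mem_conjv[Y SY ->].
rewrite lie_bracket_conj; last by case: Sp.
by apply/mem_conjv; exists (lie_bracket X Y); rewrite ?brS.
Qed.

Lemma diagonalizable_conj g X : g \in unitmx ->
  diagonalizable X -> diagonalizable (g *m X *m invmx g).
Proof.
move=> gu [P Pu /(similar_diagP _ Pu) dX]; exists (P *m invmx g).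
  by rewrite unitmx_mul Pu unitmx_inv.
apply/similar_diagP; first by rewrite unitmx_mul Pu unitmx_inv.
move=> i j neq; rewrite invmxM ?unitmx_inv // invmxK !mulmxA !mulmxKV //.
exact: dX.
Qed.

Lemma cartan_subalgebra_conj g H :
  in_Sp4 g -> cartan_subalgebra H -> cartan_subalgebra (conjv g H).
Proof.
move=> Sp [saH dH cH diH]; have [gu _] := Sp; split.
- exact: sp4_subalgebra_conj.
- by rewrite dim_conjv.
- move=> _ _ /mem_conjv[X SX ->] /mem_conjv[Y SY ->].
  by rewrite lie_bracket_conj // cH // mulmx0 mul0mx.
- by move=> _ /mem_conjv[X SX ->]; apply/diagonalizable_conj/diH.
Qed.

Lemma Sp4_equivalent_conj g S H :
  in_Sp4 g -> Sp4_equivalent (conjv g S) H -> Sp4_equivalent S H.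
Proof.
move=> Sp [h Sph <-]; exists (h *m g); first exact: in_Sp4_mul.
by rewrite conjv_comp.
Qed.

Lemma dim_span3 (u v w : 'M[F]_4) :
  (forall a b c, a *: u + b *: v + c *: w = 0 -> [/\ a = 0, b = 0 & c = 0]) ->
  \dim <<[:: u; v; w]>> = 3%N.
Proof.
move=> h; suff /eqP -> : free [tuple u; v; w] by [].
apply/freeP => k; rewrite !big_ord_recr big_ord0 /= add0r => /h[a0 b0 c0].
by case=> -[|[|[|i]]] lti //; [rewrite -[RHS]a0|rewrite -[RHS]b0|rewrite -[RHS]c0];
 congr k; apply: val_inj.
Qed.

(** Equal dimensions reduce equivalence to one inclusion, checked on three generators. The
    conditions are written g X = X' g so that no inverse has to be computed. *)
Lemma Sp4_equivalent_span3 g S (X Y Z X' Y' Z' : 'M[F]_4) :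
  in_Sp4 g -> \dim S = 3%N -> \dim <<[:: X'; Y'; Z']>> = 3%N ->
  X \in S -> Y \in S -> Z \in S ->
  g *m X = X' *m g -> g *m Y = Y' *m g -> g *m Z = Z' *m g ->
  Sp4_equivalent S <<[:: X'; Y'; Z']>>.
Proof.
move=> Sp dS d3 SX SY SZ gX gY gZ; exists g => //; have [gu _] := Sp.
apply/esym/eqP; rewrite eqEdim dim_conjv // dS d3 leqnn andbT.
by apply/span_subvP=> W; rewrite !inE => /or3P[]/eqP->; apply/mem_conjv;
  [exists X | exists Y | exists Z] => //; rewrite ?gX ?gY ?gZ mulmxK.
Qed.

End Conjugation.

(** * Membership in spans of two or three matrices *)

Section Span.

Variables (F : fieldType) (n : nat).

Implicit Types u v w X : 'M[F]_n.

Lemma memv_span2P u v X :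
  reflect (exists a b, X = a *: u + b *: v) (X \in <<[:: u; v]>>%VS).
Proof.
rewrite span_cons span_seq1; apply: (iffP memv_addP).
  by case=> _ /vlineP[a ->] [_ /vlineP[b ->] ->]; exists a, b.
by case=> a [b ->]; exists (a *: u); rewrite ?memvZ ?memv_line //;
  exists (b *: v); rewrite ?memvZ ?memv_line.
Qed.

Lemma memv_span3P u v w X :
  reflect (exists a b c, X = a *: u + b *: v + c *: w) (X \in <<[:: u; v; w]>>%VS).
Proof.
rewrite span_cons; apply: (iffP memv_addP).
  case=> _ /vlineP[a ->] [_ /memv_span2P[b [c ->]] ->].
  by exists a, b, c; rewrite addrA.
case=> a [b [c ->]]; exists (a *: u); first by rewrite memvZ ?memv_line.
by exists (b *: v + c *: w); rewrite ?addrA //; apply/memv_span2P; exists b, c.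
Qed.

End Span.

(** The polynomial X^4 - c X^2 = X (X^3 - c X) has the same roots as X^3 - c X, since 0 is a root of
    the latter. For c = 0 the only root is 0, so X itself annihilates A. *)
Lemma diagonalizable_cube (F : fieldType) (n : nat) (A : 'M[F]_n.+1) (c : F) :
  diagonalizable A -> A *m A *m A *m A = c *: (A *m A) ->
  A *m A *m A = c *: A /\ (c = 0 -> A = 0).
Proof.
move=> dA A4.
have A40 : horner_mx A ('X^4 - c *: 'X^2) = 0.
  rewrite rmorphB /= horner_mxZ ?rmorphXn /= horner_mx_X.
  by rewrite !exprSr expr0 mul1r -!mulmxE A4 subrr.
split=> [|c0].
  have : horner_mx A ('X^3 - c *: 'X) = 0.
    apply: diagonalizable_horner0 dA _ A40 => x; rewrite /root.
    have -> : 'X^4 - c *: 'X^2 = 'X * ('X^3 - c *: 'X) :> {poly F}.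
      by rewrite mulrBr -exprS -scalerAr -expr2.
    by rewrite hornerM hornerX mulf_eq0 => /orP[/eqP->|//]; rewrite !hornerE expr0n subrr.
  rewrite rmorphB /= horner_mxZ ?rmorphXn /= horner_mx_X => /eqP.
  by rewrite !exprSr expr0 mul1r -!mulmxE subr_eq0 => /eqP.
rewrite -(horner_mx_X A); apply: diagonalizable_horner0 dA _ A40 => x.
by rewrite /root c0 scale0r subr0 !hornerE expf_eq0.
Qed.

(** * Semisimple elements of the Borel subalgebra *)

Section SemisimpleElements.

Variable F : numFieldType.

Implicit Types (a b x y z w p q m n : F) (S : {vspace 'M[F]_4}).

(** In the index order 1, 2, 4, 3 the matrix is triangular with diagonal a, b, -b, -a. If a and b
    are nonzero, the coordinates of a null row vector vanish in that order. *)
Lemma eigenvalue0_bor a b x y z w :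
  eigenvalue (bor a b x y z w) 0 -> a * b = 0.
Proof.
case/eigenvalueP=> v vX v0; apply/eqP; apply: contraNT v0.
rewrite mulf_eq0 negb_or => /andP[a0 b0].
have e (j : 'I_4) : \sum_i v 0 i * bor a b x y z w i j = 0.
  by have /rowP/(_ j) := vX; rewrite scale0r !mxE.
move: (e (inord 0)) (e (inord 1)) (e (inord 2)) (e (inord 3)).
rewrite !big_ord_recr !big_ord0 /= !mxE !inordK //= !(mulr0, addr0, add0r).
set v1 := v _ _; set v2 := v _ _; set v3 := v _ _; set v4 := v _ _.
have z0 (c d : F) : c * d = 0 -> d != 0 -> c = 0.
  by move=> /eqP + d0; rewrite mulf_eq0 (negPf d0) orbF => /eqP.
have [Na0 Nb0] : - a != 0 /\ - b != 0 by rewrite !oppr_eq0.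
move=> /z0/(_ a0) v10; rewrite v10 !mul0r !add0r => /z0/(_ b0) v20.
rewrite v20 !mul0r !add0r => + /z0/(_ Nb0) v40.
rewrite v40 mul0r addr0 => /z0/(_ Na0) v30.
apply/eqP/rowP=> i; rewrite mxE.
by case: i => -[|[|[|[|i]]]] // lti; [rewrite -[RHS]v10|rewrite -[RHS]v20|
  rewrite -[RHS]v30|rewrite -[RHS]v40]; congr (v _ _); apply: val_inj.
Qed.

(* The (1,4) entry is forced by the symplectic condition. *)
Definition unip p q m n : 'M[F]_4 := mx4 [:: [:: 1; p; q; m + p * n];
  [:: 0; 1; m; n]; [:: 0; 0; 1; 0]; [:: 0; 0; -p; 1]].

Lemma unip_Sp4 p q m n : in_Sp4 (unip p q m n).
Proof.
by apply: in_Sp4I; rewrite /unip; mx4_ring.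
Qed.

(** Conjugation fixes the torus part. The parameters n, p, m + p n, q enter the coefficients of
    [X_a], [X_b], [X_ab], [X_a2b] multiplied, up to sign, by the weights 2b, a - b, a + b, 2a, so a
    coefficient of nonzero weight can be removed. *)
Lemma unip_bor p q m n a b x y z w :
  let y' := y + p * b - a * p in
  let z' := z + p * x - (m + p * n) * (a + b) - y' * n in
  unip p q m n *m bor a b x y z w =
  bor a b (x - n * b *+ 2) y' z'
    (w + p * z - q * a *+ 2 - (m + p * n) * y - y' * m + z' * p) *m unip p q m n.
Proof. by move=> y' z'; rewrite /z' /y' /unip; mx4_ring. Qed.

Lemma conjv_unip_borel p q m n : (conjv (unip p q m n) (borel F) <= borel F)%VS.
Proof.
have [gu _] := unip_Sp4 p q m n.
apply/subvP=> _ /mem_conjv[_ /mem_borelP[a [b [x [y [z [w ->]]]]]] ->].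
by rewrite unip_bor mulmxK //; apply/mem_borelP; do 6! eexists.
Qed.

Lemma semisimple_conj_T (X : 'M[F]_4) :
  X \in borel F -> X != 0 -> diagonalizable X -> eigenvalue X 0 ->
  exists p q m n c, c != 0 /\
    (unip p q m n *m X = (c *: T 1 0) *m unip p q m n \/
     unip p q m n *m X = (c *: T 0 1) *m unip p q m n).
Proof.
case/mem_borelP=> a [b [x [y [z [w ->]]]]] X0 dX /eigenvalue0_bor/eqP ab0.
have n2 : 2%:R != 0 :> F by rewrite Num.Theory.pnatr_eq0.
case: (eqVneq a 0) X0 dX ab0 => [-> | a0] X0 dX; last first.
  rewrite mulf_eq0 (negPf a0) /= => /eqP b0; move: dX; rewrite b0 => dX.
  have [|X3 _] := diagonalizable_cube (c := a ^+ 2) dX.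
    by rewrite /bor !mx4M mx4Z; congr (mx4 _); do ![congr (_ :: _)]; ring.
  (* X_a has weight 0 for T 1 0, so x cannot be removed by conjugation. *)
  have x0 : x = 0.
    have /matrixP/(_ (inord 1) (inord 3)) := X3.
    rewrite /bor !mx4M mx4Z !mxE !inordK //= => e.
    have : a ^+ 2 * x = 0 by rewrite -e; ring.
    by move/eqP; rewrite mulf_eq0 expf_eq0 (negPf a0) => /eqP.
  (* With b = 0 and x = 0, these values of p, m, q make the new [X_b], [X_ab], [X_a2b] coefficients
     zero in turn. *)
  exists (y / a), (w / a / 2%:R), (z / a), 0, a; split=> //; left.
  by rewrite unip_bor !bor_basis borZ x0; congr (bor _ _ _ _ _ _ *m _);
    field; rewrite ?a0.
move=> _; case: (eqVneq b 0) X0 dX => [b0|b0] X0 dX.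
  (* With zero torus part the element is nilpotent, and a diagonalizable nilpotent matrix is
     zero. *)
  have [|_ X00] := diagonalizable_cube (c := 0) dX.
    by rewrite b0 /bor !mx4M mx4Z; congr (mx4 _); do ![congr (_ :: _)]; ring.
  by rewrite X00 ?eqxx in X0.
have [|X3 _] := diagonalizable_cube (c := b ^+ 2) dX.
  by rewrite /bor !mx4M mx4Z; congr (mx4 _); do ![congr (_ :: _)]; ring.
(* The same for the weight 0 component of X_a2b with respect to T 0 1. *)
have w0 : w = (2%:R * y * z - y ^+ 2 * x / b) / b.
  have /matrixP/(_ (inord 0) (inord 2)) := X3.
  rewrite /bor !mx4M mx4Z !mxE !inordK //= => e.
  have -> : w = b ^- 2 * (b ^+ 2 * w) by field.
  by rewrite -e; field.
(* With a = 0, the values of p and n clear [X_b] and [X_a], then m clears [X_ab]; by [w0] the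
   [X_a2b] coefficient is then zero already, so q = 0. *)
exists (- y / b), 0, (z / b - x * y / b ^+ 2 / 2%:R), (x / b / 2%:R), b.
split=> //; right; rewrite unip_bor !bor_basis borZ w0.
by congr (bor _ _ _ _ _ _ *m _);
    field; rewrite ?b0.
Qed.

Lemma torus_cartan : cartan_subalgebra (torus F).
Proof.
split.
- split=> [X /mem_torus[a [b ->]]|X Y /mem_torus[a [b ->]] /mem_torus[a' [b' ->]]].
    by rewrite T_bor; apply: bor_sp4.
  rewrite !T_bor bor_bracket; apply/mem_torus; exists 0, 0.
  by rewrite T_bor; congr bor; ring.
- suff /eqP -> : free [tuple (T 1 0 : 'M[F]_4); T 0 1] by [].
  apply/freeP=> k; rewrite !big_ord_recr big_ord0 /= add0r !bor_basis !borZ borD.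
  rewrite -bor0 => /bor_inj[]; rewrite !mulr0 !mulr1 addr0 add0r => k0 k1 _ _ _.
  by case=> -[|[|i]] lti //; [rewrite -[RHS]k0|rewrite -[RHS]k1];
    congr k; apply: val_inj.
- move=> X Y /mem_torus[a [b ->]] /mem_torus[a' [b' ->]].
  by rewrite !T_bor bor_bracket -bor0; congr bor; ring.
- by move=> X /mem_torus[a [b ->]]; apply: diagonalizable_diag.
Qed.

Definition contains_cartan S := exists H : {vspace 'M[F]_4},
  cartan_subalgebra H /\ (H <= S)%VS.

Lemma contains_cartan_conj g S :
  in_Sp4 g -> contains_cartan (conjv g S) -> contains_cartan S.
Proof.
move=> Sp [H [cH sHS]]; exists (conjv (invmx g) H); split.
  by apply: cartan_subalgebra_conj => //; apply: in_Sp4_inv.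
by rewrite -[X in (_ <= X)%VS](conjvK S Sp) conjvS.
Qed.

(** The form in which the absence of a Cartan subalgebra is used: a single g may not carry two
    elements of S to [T 1 0] and [T 0 1]. *)
Lemma contains_cartan_torus g S X Y : in_Sp4 g -> X \in S -> Y \in S ->
  g *m X = T 1 0 *m g -> g *m Y = T 0 1 *m g -> contains_cartan S.
Proof.
move=> Sp SX SY gX gY; apply: (contains_cartan_conj Sp).
have [gu _] := Sp.
exists (torus F); split; first exact: torus_cartan.
by apply/span_subvP=> W; rewrite !inE => /orP[]/eqP->; apply/mem_conjv;
  [exists X | exists Y]; rewrite ?gX ?gY ?mulmxK.
Qed.

End SemisimpleElements.

(** * Classification up to equivalence *)

Section Classification.

Variable F : numFieldType.

Implicit Types (S : {vspace 'M[F]_4}) (a b x y z w : F).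

Ltac memv_comb := repeat first [done | apply: memvD | apply: memvZ].

Ltac bor_field := rewrite ?bor_basis ?borZ ?borD ?borZ ?borD; congr bor; field.

Definition A1 : {vspace 'M[F]_4} := <<[:: T 1 0; X_a F; X_ab F]>>%VS.
Definition A2 : {vspace 'M[F]_4} := <<[:: T 1 0; X_a F; X_a2b F]>>%VS.
Definition A3 : {vspace 'M[F]_4} := <<[:: T 1 0; X_ab F; X_a2b F]>>%VS.

Let n2 : 2%:R != 0 :> F. Proof. by rewrite Num.Theory.pnatr_eq0. Qed.

Lemma dim_A1 : \dim A1 = 3%N.
Proof.
apply: dim_span3 => a b c; rewrite !bor_basis !borZ !borD -bor0 => /bor_inj.
by rewrite !(mulr0, mulr1, addr0, add0r) => -[-> _ -> _ [-> _]].
Qed.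

Lemma dim_A2 : \dim A2 = 3%N.
Proof.
apply: dim_span3 => a b c; rewrite !bor_basis !borZ !borD -bor0 => /bor_inj.
by rewrite !(mulr0, mulr1, addr0, add0r) => -[-> _ -> _ [_ ->]].
Qed.

Lemma dim_A3 : \dim A3 = 3%N.
Proof.
apply: dim_span3 => a b c; rewrite !bor_basis !borZ !borD -bor0 => /bor_inj.
by rewrite !(mulr0, mulr1, addr0, add0r) => -[-> _ _ _ [-> ->]].
Qed.

Lemma dim_span2_lt3 S (u v : 'M[F]_4) : \dim S = 3%N -> ~ (S <= <<[:: u; v]>>)%VS.
Proof.
by move=> dS /dimvS; rewrite dS => /leq_trans/(_ (dim_span _)).
Qed.

Lemma memv_scaleI S (u : 'M[F]_4) c : c != 0 -> c *: u \in S -> u \in S.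
Proof. by move=> c0 Scu; rewrite -[u]scale1r -(mulVf c0) -scalerA memvZ. Qed.

Lemma memv_scale_eq0 S (u : 'M[F]_4) c : u \notin S -> c *: u \in S -> c = 0.
Proof.
by move=> nSu Scu; apply: contraNeq nSu => c0; apply: memv_scaleI Scu.
Qed.

Lemma bracket_T10 a b x y z w :
  lie_bracket (T 1 0) (bor a b x y z w) = bor 0 0 0 y z (2%:R * w) :> 'M[F]_4.
Proof. by rewrite T_bor bor_bracket; congr bor; ring. Qed.

Lemma bracket_T01 a b x y z w :
  lie_bracket (T 0 1) (bor a b x y z w) = bor 0 0 (2%:R * x) (- y) z 0 :> 'M[F]_4.
Proof. by rewrite T_bor bor_bracket; congr bor; ring. Qed.

(** The adjoint action of [T 1 0] has eigenvalues 0, 1, 2 on the Borel subalgebra, and polynomials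
    in it preserve S. [X_b] and [X_ab] share the weight 1, so they stay together. *)
Lemma weights_T10 S a b x y z w :
  (forall X Y, X \in S -> Y \in S -> lie_bracket X Y \in S) ->
  T 1 0 \in S -> bor a b x y z w \in S ->
  [/\ bor 0 b x 0 0 0 \in S, bor 0 0 0 y z 0 \in S & w *: X_a2b F \in S].
Proof.
move=> brS ST SM; have ad M := brS _ M ST.
have := ad _ SM; rewrite bracket_T10 => SM1.
have := ad _ SM1; rewrite bracket_T10 => SM2.
have Sw : w *: X_a2b F \in S.
  (* With D the adjoint action, (D^2 - D) / 2 kills weights 0 and 1 and is the identity on weight
     2. *)
  rewrite (_ : _ *: _ = 2%:R^-1 *: (bor 0 0 0 y z (2%:R * (2%:R * w)) +
    (-1) *: bor 0 0 0 y z (2%:R * w))); first by memv_comb.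
  by bor_field.
have Syz : bor 0 0 0 y z 0 \in S.
  rewrite (_ : bor _ _ _ _ _ _ = bor 0 0 0 y z (2%:R * w) + (- 2%:R) *: (w *: X_a2b F)).
    by memv_comb.
  by bor_field.
split=> //; rewrite (_ : bor _ _ _ _ _ _ = bor a b x y z w + (- a) *: T 1 0 +
  (-1) *: bor 0 0 0 y z 0 + (-1) *: (w *: X_a2b F)).
  by memv_comb.
by bor_field.
Qed.

(** Here [X_a], [X_b], [X_ab] have the distinct weights 2, -1, 1, so each separates; [X_a2b] has
    weight 0 and stays with the torus. *)
Lemma weights_T01 S a b x y z w :
  (forall X Y, X \in S -> Y \in S -> lie_bracket X Y \in S) ->
  T 0 1 \in S -> bor a b x y z w \in S ->
  [/\ bor a 0 0 0 0 w \in S, x *: X_a F \in S, y *: X_b F \in S & z *: X_ab F \in S].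
Proof.
move=> brS ST SM; have ad M := brS _ M ST.
have := ad _ SM; rewrite bracket_T01 => SM1.
have := ad _ SM1; rewrite bracket_T01 => SM2.
have := ad _ SM2; rewrite bracket_T01 => SM3.
have n6 : 6%:R != 0 :> F by rewrite Num.Theory.pnatr_eq0.
have Sx : x *: X_a F \in S.
  (* (D^3 - D) / 6 vanishes on weights 0, 1, -1 and is the identity on weight 2. *)
  rewrite (_ : _ *: _ = 6%:R^-1 *: (bor 0 0 (2%:R * (2%:R * (2%:R * x))) (- - - y) z 0 +
    (-1) *: bor 0 0 (2%:R * x) (- y) z 0)); first by memv_comb.
  by bor_field.
have Sz : z *: X_ab F \in S.
  (* D^2 + D kills weight -1, doubles weight 1, and multiplies weight 2 by 6; that last part is
     subtracted. *)
  rewrite (_ : _ *: _ = 2%:R^-1 *: (bor 0 0 (2%:R * (2%:R * x)) (- - y) z 0 +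
    bor 0 0 (2%:R * x) (- y) z 0 + (- 6%:R) *: (x *: X_a F))).
    by memv_comb.
  by bor_field.
have Sy : y *: X_b F \in S.
  rewrite (_ : _ *: _ = 2%:R *: (x *: X_a F) + z *: X_ab F +
    (- 1) *: bor 0 0 (2%:R * x) (- y) z 0).
    by memv_comb.
  by bor_field.
split=> //; rewrite (_ : bor _ _ _ _ _ _ = bor a b x y z w + (- b) *: T 0 1 +
  (-1) *: (x *: X_a F) + (-1) *: (y *: X_b F) + (-1) *: (z *: X_ab F)).
  by memv_comb.
by bor_field.
Qed.

Definition equiv_A1_A2_or_A3 S :=
  [\/ Sp4_equivalent S A1, Sp4_equivalent S A2 | Sp4_equivalent S A3].

Lemma Sp4_id : in_Sp4 (1%:M : 'M[F]_4).
Proof. by apply: in_Sp4I; rewrite trmx1 mulmx1 mul1mx. Qed.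

Lemma classification_T10 S :
  (forall X Y, X \in S -> Y \in S -> lie_bracket X Y \in S) ->
  (S <= borel F)%VS -> \dim S = 3%N -> ~ contains_cartan S ->
  T 1 0 \in S -> equiv_A1_A2_or_A3 S.
Proof.
move=> brS Sb dS nC ST.
have coordS M : M \in S -> exists a x y z w, [/\ M = bor a 0 x y z w,
    x *: X_a F \in S, bor 0 0 0 y z 0 \in S & w *: X_a2b F \in S].
  move=> SM; have /mem_borelP[a [b [x [y [z [w ME]]]]]] := subvP Sb _ SM.
  move: SM; rewrite {}ME => SM; have [Sbx Syz Sw] := weights_T10 brS ST SM.
  have b0 : b = 0.
    (* For b nonzero, a unipotent element commuting with [T 1 0] carries the rescaled weight zero
       part to [T 0 1]. *)
    have [//|b0] := eqVneq b 0; case: nC.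
    apply: (contains_cartan_torus (unip_Sp4 0 0 0 (x / b / 2%:R)) ST (memvZ b^-1 Sbx)).
      by rewrite bor_basis unip_bor; congr (_ *m _); bor_field.
    by rewrite bor_basis borZ unip_bor; congr (bor _ _ _ _ _ _ *m _);
    field; rewrite ?b0.
  exists a, x, y, z, w; split=> //; first by rewrite b0.
  by rewrite (_ : _ *: _ = bor 0 b x 0 0 0) // b0; bor_field.
have [Sa|nSa] := boolP (X_a F \in S).
  have [Sab|nSab] := boolP (X_ab F \in S).
    by apply: Or31; apply: (Sp4_equivalent_span3 Sp4_id dS dim_A1 ST Sa Sab);
      rewrite mul1mx mulmx1.
  have [Sw|nSw] := boolP (X_a2b F \in S).
    by apply: Or32; apply: (Sp4_equivalent_span3 Sp4_id dS dim_A2 ST Sa Sw);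
      rewrite mul1mx mulmx1.
  (* With neither [X_ab] nor [X_a2b] in S, no further dimension is available: bracketing y [X_b] + z
     [X_ab] with [X_a] gives y [X_ab], so y = 0 and then z = 0. *)
  case: (@dim_span2_lt3 S (T 1 0) (X_a F) dS).
  apply/subvP=> M SM; have [a [x [y [z [w [-> _ Syz Sw]]]]]] := coordS _ SM.
  have w0 : w = 0.
    by have [//|w0] := eqVneq w 0; rewrite (memv_scaleI w0 Sw) in nSw.
  have y0 : y = 0.
    have [//|y0] := eqVneq y 0; case/negP: nSab; apply: (memv_scaleI y0).
    have := brS _ _ Syz Sa; rewrite X_a_bor bor_bracket.
    by congr (_ \in S); bor_field.
  have z0 : z = 0.
    have [//|z0] := eqVneq z 0; case/negP: nSab; apply: (memv_scaleI z0).
    by move: Syz; rewrite y0; congr (_ \in S); bor_field.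
  by apply/memv_span2P; exists a, x; rewrite y0 z0 w0; bor_field.
have x0 x : x *: X_a F \in S -> x = 0.
  by move=> Sx; have [//|x0] := eqVneq x 0; rewrite (memv_scaleI x0 Sx) in nSa.
have [Sw|nSw] := boolP (X_a2b F \in S); last first.
  (* Without [X_a] and [X_a2b], dimension forces this span, which is not closed since [[X_b],
     [X_ab]] = 2 [X_a2b]. *)
  have eqS : S = <<[:: T 1 0; X_b F; X_ab F]>>%VS.
    apply/eqP; rewrite eqEdim dS dim_span andbT; apply/subvP=> M SM.
    have [a [x [y [z [w [-> /x0-> Syz Sw]]]]]] := coordS _ SM.
    have w0 : w = 0.
      by have [//|w0] := eqVneq w 0; rewrite (memv_scaleI w0 Sw) in nSw.
    by apply/memv_span3P; exists a, y, z; rewrite w0; bor_field.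
  case/negP: nSw; apply: (memv_scaleI n2).
  have SXb : X_b F \in S by rewrite eqS memv_span // !inE eqxx orbT.
  have SXab : X_ab F \in S by rewrite eqS memv_span // !inE eqxx !orbT.
  have := brS _ _ SXb SXab; rewrite X_b_bor X_ab_bor bor_bracket.
  by congr (_ \in S); bor_field.
have /subvPn[M SM nM] : ~~ (S <= <<[:: T 1 0; X_a2b F]>>)%VS.
  by apply/negP/dim_span2_lt3.
have [a [x [y [z [w [ME /x0 x0' Syz _]]]]]] := coordS _ SM.
have yz0 : (y != 0) || (z != 0).
  apply: contraR nM; rewrite negb_or !negbK => /andP[/eqP y0 /eqP z0].
  by apply/memv_span2P; exists a, w; rewrite ME x0' y0 z0; bor_field.
(* The nonzero row (y, z) is completed to a 2 by 2 matrix of determinant 1, which then acts on the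
   indices 2, 4 and takes y [X_b] + z [X_ab] to [X_ab]. *)
have [h1 [h2 det1]] : exists h1 h2, h1 * z = 1 + h2 * y.
  have [z0|z0] := eqVneq z 0.
    rewrite z0 eqxx orbF in yz0; exists 0, (- y^-1).
    by rewrite mul0r mulNr mulVf // subrr.
  by exists z^-1, 0; rewrite mulVf // mul0r addr0.
pose g : 'M[F]_4 := mx4 [:: [:: 1; 0; 0; 0]; [:: 0; h1; 0; h2];
  [:: 0; 0; 1; 0]; [:: 0; y; 0; z]].
have Sp : in_Sp4 g.
  apply: in_Sp4I; rewrite /g J_mx4 mx4_tr !mx4M; congr (mx4 _).
  by do ![congr (_ :: _)]; ring: det1.
apply: Or33; apply: (Sp4_equivalent_span3 Sp dS dim_A3 ST Syz Sw);
  rewrite !bor_basis /g /bor !mx4M; congr (mx4 _);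
  by do ![congr (_ :: _)]; ring: det1.
Qed.

(** S is spanned by [T 0 1] and two root vectors. The pairs {[X_a], [X_b]} and {[X_b], [X_ab]} are
    not closed under brackets; the other four are moved to normal form by [s] or [r]. *)
Lemma classification_T01 S :
  (forall X Y, X \in S -> Y \in S -> lie_bracket X Y \in S) ->
  (S <= borel F)%VS -> \dim S = 3%N -> ~ contains_cartan S ->
  T 0 1 \in S -> equiv_A1_A2_or_A3 S.
Proof.
move=> brS Sb dS nC ST.
have coordS M : M \in S -> exists b x y z w, M = bor 0 b x y z w /\
    [/\ x *: X_a F \in S, y *: X_b F \in S, z *: X_ab F \in S & w *: X_a2b F \in S].
  move=> SM; have /mem_borelP[a [b [x [y [z [w ME]]]]]] := subvP Sb _ SM.
  move: SM; rewrite {}ME => SM; have [Saw Sx Sy Sz] := weights_T01 brS ST SM.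
  have a0 : a = 0.
    have [//|a0] := eqVneq a 0; case: nC.
    (* The parameter q removes the [X_a2b] term while fixing [T 0 1]. *)
    apply: (contains_cartan_torus (unip_Sp4 0 (w / a / 2%:R) 0 0) (memvZ a^-1 Saw) ST).
      by rewrite bor_basis borZ unip_bor; congr (bor _ _ _ _ _ _ *m _);
    field; rewrite ?a0.
    by rewrite bor_basis unip_bor; congr (bor _ _ _ _ _ _ *m _); field.
  exists b, x, y, z, w; split; first by rewrite a0.
  split=> //; by rewrite (_ : _ *: _ = bor a 0 0 0 0 w) // a0; bor_field.
(* The Weyl group element exchanging the indices 1, 3 with 2, 4. *)
pose s : 'M[F]_4 := mx4 [:: [:: 0; 1; 0; 0]; [:: 1; 0; 0; 0];
  [:: 0; 0; 0; 1]; [:: 0; 0; 1; 0]].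
have Sps : in_Sp4 s.
  by apply: in_Sp4I; rewrite /s; mx4_ring.
have sT : s *m T 0 1 = T 1 0 *m s by rewrite !bor_basis /s; mx4_ring.
have sa : s *m X_a F = X_a2b F *m s by rewrite !bor_basis /s; mx4_ring.
have sab : s *m X_ab F = X_ab F *m s by rewrite !bor_basis /s; mx4_ring.
have sa2b : s *m X_a2b F = X_a F *m s by rewrite !bor_basis /s; mx4_ring.
have [Sa|nSa] := boolP (X_a F \in S); have [Sab|nSab] := boolP (X_ab F \in S).
- by apply: Or33; apply: (Sp4_equivalent_span3 Sps dS dim_A3 ST Sab Sa).
- have nSb : X_b F \notin S.
    apply: contra nSab => SXb; have := brS _ _ SXb Sa.
    by rewrite X_a_bor X_b_bor X_ab_bor bor_bracket; congr (_ \in S); bor_field.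
  have [Sw|nSw] := boolP (X_a2b F \in S).
    by apply: Or32; apply: (Sp4_equivalent_span3 Sps dS dim_A2 ST Sw Sa).
  case: (@dim_span2_lt3 S (T 0 1) (X_a F) dS).
  apply/subvP=> M /coordS[b [x [y [z [w [-> [_]]]]]]].
  move=> /(memv_scale_eq0 nSb)-> /(memv_scale_eq0 nSab)-> /(memv_scale_eq0 nSw)->.
  by apply/memv_span2P; exists b, x; bor_field.
- have [Sw|nSw] := boolP (X_a2b F \in S).
    by apply: Or31; apply: (Sp4_equivalent_span3 Sps dS dim_A1 ST Sw Sab).
  have nSb : X_b F \notin S.
    apply: contra nSw => SXb; apply: (memv_scaleI n2).
    have := brS _ _ SXb Sab.
    by rewrite X_ab_bor X_b_bor bor_bracket; congr (_ \in S); bor_field.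
  case: (@dim_span2_lt3 S (T 0 1) (X_ab F) dS).
  apply/subvP=> M /coordS[b [x [y [z [w [-> [+ + _]]]]]]].
  move=> /(memv_scale_eq0 nSa)-> /(memv_scale_eq0 nSb)-> /(memv_scale_eq0 nSw)->.
  by apply/memv_span2P; exists b, z; bor_field.
(* With [X_a] and [X_ab] excluded, dimension 3 forces both [X_b] and [X_a2b] into S. *)
have [Sb'|nSb] := boolP (X_b F \in S); last first.
  case: (@dim_span2_lt3 S (T 0 1) (X_a2b F) dS).
  apply/subvP=> M /coordS[b [x [y [z [w [-> []]]]]]].
  move=> /(memv_scale_eq0 nSa)-> /(memv_scale_eq0 nSb)-> /(memv_scale_eq0 nSab)-> _.
  by apply/memv_span2P; exists b, w; bor_field.
have [Sw|nSw] := boolP (X_a2b F \in S); last first.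
  case: (@dim_span2_lt3 S (T 0 1) (X_b F) dS).
  apply/subvP=> M /coordS[b [x [y [z [w [-> []]]]]]].
  move=> /(memv_scale_eq0 nSa)-> _ /(memv_scale_eq0 nSab)-> /(memv_scale_eq0 nSw)->.
  by apply/memv_span2P; exists b, y; bor_field.
(* The Weyl group element taking T 0 1, X_b, X_a2b to - T 1 0, X_ab, X_a. *)
pose r : 'M[F]_4 := mx4 [:: [:: 0; 0; 0; -1]; [:: 1; 0; 0; 0];
  [:: 0; 1; 0; 0]; [:: 0; 0; 1; 0]].
have Spr : in_Sp4 r by apply: in_Sp4I; rewrite /r; mx4_ring.
have SNT : (-1) *: T 0 1 \in S by rewrite memvZ.
by apply: Or31; apply: (Sp4_equivalent_span3 Spr dS dim_A1 SNT Sw Sb');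
  rewrite !bor_basis ?borZ /r; mx4_ring.
Qed.

(** The conjugating unipotent preserves the Borel subalgebra, so the conjugate of S satisfies the
    hypotheses of [classification_T10] or [classification_T01]. *)
Lemma classification S :
  sp4_subalgebra S -> (S <= borel F)%VS -> \dim S = 3%N ->
  (exists X, [/\ X \in S, X != 0, diagonalizable X & eigenvalue X 0]) ->
  ~ contains_cartan S -> equiv_A1_A2_or_A3 S.
Proof.
move=> saS Sb dS [X [SX X0 dX eX]] nC.
have [p [q [m [n [c [c0 gX]]]]]] := semisimple_conj_T (subvP Sb _ SX) X0 dX eX.
pose g := unip p q m n; have Sp : in_Sp4 g := unip_Sp4 p q m n; have [gu _] := Sp.
have [_ br] := sp4_subalgebra_conj Sp saS.
have Sb' := subv_trans (conjvS g Sb) (conjv_unip_borel p q m n).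
have dS' : \dim (conjv g S) = 3%N by rewrite dim_conjv.
have nC' : ~ contains_cartan (conjv g S) by move/(contains_cartan_conj Sp).
have SgX : g *m X *m invmx g \in conjv g S by apply/mem_conjv; exists X.
suff [] : equiv_A1_A2_or_A3 (conjv g S).
- by move/(Sp4_equivalent_conj Sp); apply: Or31.
- by move/(Sp4_equivalent_conj Sp); apply: Or32.
- by move/(Sp4_equivalent_conj Sp); apply: Or33.
case: gX => gX; move: SgX; rewrite gX mulmxK // => /(memv_scaleI c0).
  exact: classification_T10.
exact: classification_T01.
Qed.

(** * Inequivalence of the three algebras *)

Lemma X_ab_not_conj_X_a2b g c : g \in unitmx -> g *m X_ab F *m invmx g <> c *: X_a2b F.
Proof.
move=> gu e; have: (\rank (g *m X_ab F *m invmx g) <= 1)%N.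
  by rewrite e (leq_trans (mxrank_scale _ _)) // mxrank_delta.
rewrite mxrankMfree ?row_free_unit ?unitmx_inv //.
rewrite eqmxMfull ?row_full_unit //; apply/negP; rewrite -ltnNge.
(* P is the transpose of [X_ab]; the product is a rank 2 projection, bounding the rank of [X_ab]
   below. *)
pose P : 'M[F]_4 := mx4 [:: [:: 0; 0; 0; 0]; [:: 0; 0; 0; 0];
  [:: 0; 1; 0; 0]; [:: 1; 0; 0; 0]].
apply: leq_trans (mxrankM_maxl (X_ab F) P).
have -> : X_ab F *m P = pid_mx 2.
  by rewrite X_ab_bor /bor mx4M; mx4_entries; rewrite !mxE /=; ring.
by rewrite rank_pid_mx.
Qed.

Lemma bracket_A1 X Y : X \in A1 -> Y \in A1 ->
  exists c, lie_bracket X Y = c *: X_ab F.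
Proof.
move=> /memv_span3P[a [b [c ->]]] /memv_span3P[a' [b' [c' ->]]].
exists (a * c' - a' * c); rewrite !bor_basis !borZ !borD bor_bracket.
by congr bor; ring.
Qed.

Lemma bracket_A2 X Y : X \in A2 -> Y \in A2 ->
  exists c, lie_bracket X Y = c *: X_a2b F.
Proof.
move=> /memv_span3P[a [b [c ->]]] /memv_span3P[a' [b' [c' ->]]].
exists (2%:R * (a * c' - a' * c)); rewrite !bor_basis !borZ !borD bor_bracket.
by congr bor; ring.
Qed.

Lemma bracket_T10_X_ab : lie_bracket (T 1 0) (X_ab F) = X_ab F.
Proof. by rewrite X_ab_bor bracket_T10 mulr0. Qed.

Lemma bracket_T10_X_a2b : lie_bracket (T 1 0) (2%:R^-1 *: X_a2b F) = X_a2b F.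
Proof. by rewrite X_a2b_bor borZ bracket_T10; congr bor; field. Qed.

Lemma bracket_conjv g S S' X Y : in_Sp4 g -> conjv g S = S' ->
  X \in S -> Y \in S -> exists X' Y', [/\ X' \in S', Y' \in S' &
    lie_bracket X' Y' = g *m lie_bracket X Y *m invmx g].
Proof.
move=> [gu _] <- SX SY; exists (g *m X *m invmx g), (g *m Y *m invmx g).
by split; rewrite ?lie_bracket_conj //; apply/mem_conjv; [exists X|exists Y].
Qed.

(** [X_ab] is a bracket in S, while brackets in [A2] are multiples of [X_a2b]. Leaving S general
    covers [A1] and [A3] together. *)
Lemma not_equivalent_A2 S : T 1 0 \in S -> X_ab F \in S -> ~ Sp4_equivalent S A2.
Proof.
move=> ST Sab [g Sp gS]; have [gu _] := Sp.
have [X [Y [A2X A2Y]]] := bracket_conjv Sp gS ST Sab.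
have [c ->] := bracket_A2 A2X A2Y.
by rewrite bracket_T10_X_ab => /esym/X_ab_not_conj_X_a2b; apply.
Qed.

Lemma Sp4_equivalent_sym S S' : Sp4_equivalent S S' -> Sp4_equivalent S' S.
Proof.
by case=> g Sp <-; exists (invmx g); [exact: in_Sp4_inv | rewrite conjvK].
Qed.

Lemma not_equivalent_A3_A1 : ~ Sp4_equivalent A3 A1.
Proof.
move=> [g Sp gS]; have [gu _] := Sp.
have SX : 2%:R^-1 *: X_a2b F \in A3 by rewrite memvZ // memv_span // !inE eqxx !orbT.
have ST : T 1 0 \in A3 by rewrite memv_span // !inE eqxx.
have [X [Y [A1X A1Y]]] := bracket_conjv Sp gS ST SX.
have [c ->] := bracket_A1 A1X A1Y; rewrite bracket_T10_X_a2b => e.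
have e' : X_a2b F = c *: (invmx g *m X_ab F *m g).
  by rewrite scalemxAl scalemxAr e -(mulmxA g) mulKmx // mulmxKV.
(* A nonzero c lets the relation be inverted, making a conjugate of [X_ab] a multiple of [X_a2b]. *)
have c0 : c != 0.
  apply/eqP=> c0; move: e'; rewrite c0 scale0r X_a2b_bor -bor0 => /bor_inj[_ _ _ _ [_]].
  by move/eqP; rewrite oner_eq0.
apply: (@X_ab_not_conj_X_a2b (invmx g) c^-1); first by rewrite unitmx_inv.
by rewrite invmxK e' scalerA mulVf // scale1r.
Qed.

End Classification.

Theorem theorem7p5 (R : realType) :
  let A1 : {vspace 'M[R[i]]_4} := <<[:: T 1 0; X_a R[i]; X_ab R[i]]>>%VS in
  let A2 : {vspace 'M[R[i]]_4} := <<[:: T 1 0; X_a R[i]; X_a2b R[i]]>>%VS in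
  let A3 : {vspace 'M[R[i]]_4} := <<[:: T 1 0; X_ab R[i]; X_a2b R[i]]>>%VS in
  (forall S : {vspace 'M[R[i]]_4},
      sp4_subalgebra S ->
      (S <= borel R[i])%VS ->
      lie_solvable S ->
      \dim S = 3%N ->
      (exists X : 'M[R[i]]_4,
          [/\ X \in S, X != 0, diagonalizable X & eigenvalue X 0]) ->
      ~ (exists H : {vspace 'M[R[i]]_4}, cartan_subalgebra H /\ (H <= S)%VS) ->
      [\/ Sp4_equivalent S A1, Sp4_equivalent S A2 | Sp4_equivalent S A3])
  /\ [/\ ~ Sp4_equivalent A1 A2, ~ Sp4_equivalent A1 A3
       & ~ Sp4_equivalent A2 A3].
Proof.
move=> B1 B2 B3; split=> [S saS Sb _ dS exX nC|].
  exact: (@classification R[i] S).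
split.
- by apply: not_equivalent_A2; rewrite memv_span // !inE eqxx ?orbT.
- by move/Sp4_equivalent_sym; apply: not_equivalent_A3_A1.
- move/Sp4_equivalent_sym; apply: not_equivalent_A2;
    by rewrite memv_span // !inE eqxx ?orbT.
Qed.
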